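(* Let $D=(V,A)$ be a digraph. For $i=1,2$, let $\mathcal{C}_i$ be a crossing family over ground set $V$, and let $f_i:\mathcal{C}_i\to\mathbb{Z}$ be a crossing submodular function, where $\min_{i=1,2}f_i(U)\leq 0$ for all $U\subsetneq V$, $U\neq\emptyset$ such that $\delta^+(U)=\delta^-(U)=\emptyset$ (with the convention $f_i(U)=+\infty$ if $U\notin\mathcal{C}_i$). Let $P$ be the polyhedron defined by the linear system $$P:=\left\{y\in\mathbb{R}^A : y(\delta^+(U))-y(\delta^-(U))\leq f_i(U)\ \ \forall U\in\mathcal{C}_i,\ i=1,2\right\}.$$ Then the following statements hold: (a) The linear system above defining $P$ is totally dual integral (TDI). In particular, $P$ is an integral polyhedron. (b) For every $\ell\in(\mathbb{Z}\cup\{-\infty\})^A$ and $u\in(\mathbb{Z}\cup\{+\infty\})^A$ satisfying $\ell\leq u$ and the cut condition $$\min_{i=1,2}f_i(U)\leq u(\delta^+(U))-\ell(\delta^-(U))\quad\forall U\subsetneq V,\ U\neq\emptyset,$$ every non-empty face of $P$ contains a point $y^\star\in\mathbb{Z}^A$ satisfying $\ell\leq y^\star\leq u$.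
   Context: Digraphs are finite and may have parallel arcs. For a digraph $D=(V,A)$ and $U\subseteq V$, $\delta^+(U)$ and $\delta^-(U)$ denote the sets of arcs leaving and entering $U$, respectively. For a vector $y$ indexed by $A$ and $B\subseteq A$, $y(B):=\sum_{a\in B}y_a$. A family $\mathcal{C}$ of subsets of $V$ is a crossing family over ground set $V$ if for all $U,W\in\mathcal{C}$ with $U\cap W\neq\emptyset$ and $U\cup W\neq V$ we have $U\cap W,\,U\cup W\in\mathcal{C}$. A function $f:\mathcal{C}\to\mathbb{R}$ is crossing submodular over $\mathcal{C}$ if $f(U\cap W)+f(U\cup W)\leq f(U)+f(W)$ for all $U,W\in\mathcal{C}$ with $U\cap W\neq\emptyset$ and $U\cup W\neq V$. A linear system $Bx\leq b$ (with $B\in\mathbb{Q}^{m\times n}$, $b\in\mathbb{Q}^m$) is totally dual integral (TDI) if for each $w\in\mathbb{Z}^n$, the dual of the linear program $\max\{w^\top x: Bx\leq b\}$ has an integral optimal solution whenever the linear program admits an optimum. A polyhedron is integral if every non-empty face of it contains an integral point. *)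

(* Defs.v *)
From HB Require Import structures.
From mathcomp Require Import classical_sets reals constructive_ereal.
From mathcomp Require Import all_boot all_order all_algebra.

Set Implicit Arguments.
Unset Strict Implicit.
Unset Printing Implicit Defensive.

Import Order.TTheory GRing.Theory Num.Theory.

Local Open Scope ring_scope.

(* Parallel arcs are distinct elements of [A] with the same tail and head. *)
Record digraph (V A : finType) := Digraph { tail : A -> V; head : A -> V }.

Definition delta_out (V A : finType) (D : digraph V A) (U : {set V}) :
  {set A} := [set a | (tail D a \in U) && (head D a \notin U)].

Definition delta_in (V A : finType) (D : digraph V A) (U : {set V}) :
  {set A} := [set a | (tail D a \notin U) && (head D a \in U)].

Definition crossing_pair (V : finType) (U W : {set V}) : bool :=
  (U :&: W != finset.set0) && (U :|: W != finset.setT).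

Definition crossing_family (V : finType) (C : {set {set V}}) : Prop :=
  forall U W : {set V}, U \in C -> W \in C -> crossing_pair U W ->
    (U :&: W \in C) /\ (U :|: W \in C).

(* A function on the family [C] is represented by a total function on
   [{set V}] whose values outside [C] are never used. *)
Definition crossing_submodular (V : finType) (C : {set {set V}})
    (f : {set V} -> int) : Prop :=
  forall U W : {set V}, U \in C -> W \in C -> crossing_pair U W ->
    f (U :&: W) + f (U :|: W) <= f U + f W.

Definition extend_oo (V : finType) (C : {set {set V}}) (f : {set V} -> int)
    (U : {set V}) : \bar int :=
  if U \in C then (f U)%:E%E else +oo%E.

Definition min_ext (V : finType) (C : 'I_2 -> {set {set V}})
    (f : 'I_2 -> {set V} -> int) (U : {set V}) : \bar int :=
  \big[Order.min/+oo%E]_(i < 2) extend_oo (C i) (f i) U.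

Definition int_point (R : realType) (I : finType) (y : {ffun I -> int}) :
  {ffun I -> R} := [ffun i => (y i)%:~R].

Definition dotp (R : realType) (I : finType) (c x : {ffun I -> R}) : R :=
  \sum_i c i * x i.

Definition is_maximizer (R : realType) (T : Type) (S : set T) (obj : T -> R)
    (x : T) : Prop :=
  S x /\ forall x', S x' -> obj x' <= obj x.

Definition is_minimizer (R : realType) (T : Type) (S : set T) (obj : T -> R)
    (x : T) : Prop :=
  S x /\ forall x', S x' -> obj x <= obj x'.

(* In the linear system [B x <= b], the rows are indexed by [I] and the
   variables by [J]. *)
Definition solutions (R : realType) (I J : finType) (B : I -> J -> rat)
    (b : I -> rat) : set {ffun J -> R} :=
  fun x => forall i, \sum_j ratr (B i j) * x j <= ratr (b i).
Arguments solutions R {I J} B b.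

Definition dual_solutions (R : realType) (I J : finType) (B : I -> J -> rat)
    (w : {ffun J -> R}) : set {ffun I -> R} :=
  fun z => (forall i, 0 <= z i) /\
           (forall j, \sum_i z i * ratr (B i j) = w j).

Definition totally_dual_integral (R : realType) (I J : finType)
    (B : I -> J -> rat) (b : I -> rat) : Prop :=
  forall w : {ffun J -> int},
    (exists x : {ffun J -> R},
       is_maximizer (solutions R B b) (dotp (int_point R w)) x) ->
    exists z : {ffun I -> int},
      is_minimizer (dual_solutions B (int_point R w))
        (dotp [ffun i => ratr (b i)]) (int_point R z).

(* Taking [c = 0] shows that [P] is a face of itself. *)
Definition face (R : realType) (J : finType) (P F : set {ffun J -> R}) : Prop :=
  exists (c : {ffun J -> R}) (d : R),
    (forall x, P x -> dotp c x <= d) /\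
    (forall x, F x <-> P x /\ dotp c x = d).

Definition integral_polyhedron (R : realType) (J : finType)
    (P : set {ffun J -> R}) : Prop :=
  forall F : set {ffun J -> R}, face P F -> (exists x, F x) ->
    exists y : {ffun J -> int}, F (int_point R y).

Definition flow_polyhedron (R : realType) (V A : finType) (D : digraph V A)
    (C : 'I_2 -> {set {set V}}) (f : 'I_2 -> {set V} -> int) :
    set {ffun A -> R} :=
  fun y => forall (i : 'I_2) (U : {set V}), U \in C i ->
    \sum_(a in delta_out D U) y a - \sum_(a in delta_in D U) y a
      <= (f i U)%:~R.
Arguments flow_polyhedron R {V A} D C f.

(* One row for each pair (i, U) with U in C i: a set belonging to both families
   contributes two inequalities. *)
Definition system_row (V : finType) (C : 'I_2 -> {set {set V}}) : finType :=
  {r : 'I_2 * {set V} | r.2 \in C r.1}.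

Definition system_lhs (V A : finType) (D : digraph V A)
    (C : 'I_2 -> {set {set V}}) (r : system_row C) (a : A) : rat :=
  (a \in delta_out D (val r).2)%:R - (a \in delta_in D (val r).2)%:R.

Arguments system_lhs {V A} D C r a.

Definition system_rhs (V : finType) (C : 'I_2 -> {set {set V}})
    (f : 'I_2 -> {set V} -> int) (r : system_row C) : rat :=
  (f (val r).1 (val r).2)%:~R.
Arguments system_rhs {V} C f r.

Lemma solutions_systemE (R : realType) (V A : finType) (D : digraph V A)
    (C : 'I_2 -> {set {set V}}) (f : 'I_2 -> {set V} -> int)
    (y : {ffun A -> R}) :
  solutions R (system_lhs D C) (system_rhs C f) y <->
  flow_polyhedron R D C f y.
Proof.
have rowE (r : system_row C) :
    \sum_a ratr (system_lhs D C r a) * y a =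
    \sum_(a in delta_out D (val r).2) y a -
    \sum_(a in delta_in D (val r).2) y a.
  rewrite [in RHS]big_mkcond [X in _ - X]big_mkcond -sumrB.
  apply: eq_bigr => a _; rewrite /system_lhs rmorphB /= !ratr_nat mulrBl.
  by do 2!case: (_ \in _); rewrite ?mul1r ?mul0r.
split=> [sol i U CiU | sol r].
  have := sol (exist _ (i, U) CiU : system_row C).
  by rewrite rowE /system_rhs ratr_int.
by rewrite rowE /system_rhs ratr_int; apply: sol (valP r).
Qed.

(* Main.v *)
Require Import Defs.
From HB Require Import structures.
From mathcomp Require Import classical_sets reals constructive_ereal.
From mathcomp Require Import all_boot all_order all_algebra.
From mathcomp Require Import boolp.
From mathcomp Require Import zify ring lra.

Set Implicit Arguments.
Unset Strict Implicit.
Unset Printing Implicit Defensive.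

Import Order.TTheory GRing.Theory Num.Theory.

Local Open Scope ring_scope.

(** The constraints only see the excess [x] of a flow [y], the vector of net
    outflows of single nodes: the flow polyhedron is the preimage of
    [Q = {x | x(V) = 0, x(U) <= f_i(U)}].  Since [Q] is cut out by two crossing
    submodular functions, its points can be rounded and its optimal duals can be
    chosen integral, in the manner of Edmonds' intersection theorem; Hoffman's
    theorem ([feasible_flow]) lifts excesses back to flows.  The hypothesis on
    the sets without incident arcs, like the cut condition in (b), ensures that
    every integral point of [Q] is the excess of an integral flow within the
    bounds.  No linear programming duality is needed: a point of a face,
    or an optimal point, comes with its tight sets, which again form two
    crossing families, and everything is done with those.

    One crossing family.  Call [L] separated if any [u] in [L] and [v] outside
    [L] are separated by a member [U] of [T] with [u] in [U] and [v] not in [U].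
    Then the indicator of [L] is a nonnegative integral combination of members
    of [T], up to a constant ([in_cone_separated]): [L] is a disjoint union of
    nonempty intersections of members, and the complement of each of those is a
    disjoint union of complements of members.

    Rounding.  Let [x] be a point of [Q].  By the previous paragraph, the
    partition of [V] into classes that the tight sets of one family do not
    separate has integral class sums, and these sums determine the values on
    the tight sets.  Two partitions make a bipartite transportation problem, so
    [x] can be replaced by an integral [y] without changing the value of tight
    sets ([integral_rounding]).  If [y] is outside [Q], the segment from [x] to
    [y] meets the boundary where more sets are tight, and one starts again
    ([integral_dominated]).  For a point [x] of a face, the resulting [y] lies
    on the same face, because one can move from [x] slightly away from [y].
    This proves (b), and the integrality in (a) is the case of infinite bounds.

    Total dual integrality.  An integral objective with an optimum vanishes on
    circulations, hence is the difference of an integral potential [pi]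
    ([optimal_potential]).  Optimality says that [pi] has nonpositive product
    with each vector of total sum 0 that increases no tight set.  Then [pi]
    splits into two integral functions, one monotone for each tight family
    ([cone_two_families]); this splitting is a system of difference constraints,
    solved by shortest walks.  A monotone function is a sum of indicators of
    separated sets, so [pi] is an integral conic combination of tight sets up to
    a constant, which is an optimal dual solution by complementary slackness. *)

(** * Integral flows with prescribed net outflow *)

Definition net_out (K : pzRingType) (V A : finType) (D : digraph V A)
    (y : A -> K) (U : {set V}) : K :=
  \sum_(a in delta_out D U) y a - \sum_(a in delta_in D U) y a.

Lemma net_outE (K : pzRingType) (V A : finType) (D : digraph V A)
    (y : A -> K) (U : {set V}) :
  net_out D y U =
  \sum_a ((tail D a \in U)%:R - (Defs.head D a \in U)%:R) * y a.
Proof.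
rewrite /net_out big_mkcond [X in _ - X]big_mkcond -sumrB.
apply: eq_bigr => a _; rewrite !inE.
by do 2!case: (_ \in _); rewrite /= ?subrr ?subr0 ?sub0r ?mul1r ?mul0r ?mulN1r.
Qed.

Lemma sum_pred1 (K : pzRingType) (T : finType) (U : {set T}) (w : T) :
  \sum_(v in U) (w == v)%:R = (w \in U)%:R :> K.
Proof.
have [wU|wU] := boolP (w \in U).
  rewrite (bigD1 w) //= eqxx big1 ?addr0 // => v /andP[_ /negPf].
  by rewrite eq_sym => ->.
by apply: big1 => v vU; case: eqP => // wv; rewrite wv vU in wU.
Qed.

Lemma net_out_sum (K : pzRingType) (V A : finType) (D : digraph V A)
    (y : A -> K) (U : {set V}) :
  net_out D y U = \sum_(v in U) net_out D y [set v]%SET.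
Proof.
under [RHS]eq_bigr do rewrite net_outE.
rewrite net_outE exchange_big; apply: eq_bigr => a _ /=.
rewrite -mulr_suml sumrB; congr ((_ - _) * _);
  by rewrite -[LHS]sum_pred1; apply: eq_bigr => v _; rewrite inE.
Qed.

Lemma net_outT (K : pzRingType) (V A : finType) (D : digraph V A) (y : A -> K) :
  net_out D y finset.setT = 0.
Proof. by rewrite net_outE big1 // => a _; rewrite !inE subrr mul0r. Qed.

Lemma net_out_int (K : pzRingType) (V A : finType) (D : digraph V A)
    (y : A -> int) (U : {set V}) :
  net_out D (fun a => (y a)%:~R) U = (net_out D y U)%:~R :> K.
Proof. by rewrite /net_out rmorphB !rmorph_sum. Qed.

Definition cut_cap (K : pzRingType) (V A : finType) (D : digraph V A)
    (l u : A -> K) (U : {set V}) : K :=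
  \sum_(a in delta_out D U) u a - \sum_(a in delta_in D U) l a.

Lemma cut_capE (K : pzRingType) (V A : finType) (D : digraph V A)
    (l u : A -> K) (U : {set V}) :
  cut_cap D l u U =
  \sum_a ((a \in delta_out D U)%:R * u a - (a \in delta_in D U)%:R * l a).
Proof.
rewrite /cut_cap big_mkcond [X in _ - X]big_mkcond -sumrB.
by apply: eq_bigr => a _; do 2!case: (_ \in _); rewrite ?mul1r ?mul0r.
Qed.

Lemma sum_setUI (K : nmodType) (T : finType) (x : T -> K) (U W : {set T}) :
  \sum_(v in U :&: W) x v + \sum_(v in U :|: W) x v =
  \sum_(v in U) x v + \sum_(v in W) x v.
Proof.
rewrite !(big_mkcond (fun v => v \in _)) -!big_split; apply: eq_bigr => v _ /=.
by rewrite !inE; case: (v \in U); case: (v \in W); rewrite /= ?add0r ?addr0.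
Qed.

(** An arc that leaves [U] and enters [W] joins [U :\: W] to [W :\: U], so it
    counts for the cuts of [U] and [W] but not for those of [U :&: W] and
    [U :|: W]; this strict gain is what leaves room for a common value in
    [feasible_flow]. *)
Lemma cut_cap_submod (V A : finType) (D : digraph V A) (l u : A -> int)
    (U W : {set V}) (a : A) :
  (forall e, l e <= u e) -> a \in delta_out D U -> a \in delta_in D W ->
  cut_cap D l u (U :&: W) + cut_cap D l u (U :|: W) + (u a - l a) <=
  cut_cap D l u U + cut_cap D l u W.
Proof.
move=> lu aU aW; rewrite !cut_capE -!big_split /=.
rewrite [in leLHS](bigD1 a) //= [leRHS](bigD1 a) //= addrAC; apply: lerD.
  move: aU aW (lu a); rewrite !inE => /andP[-> /negPf->] /andP[/negPf-> ->] /=.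
  lia.
apply: ler_sum => e _; move: (lu e); rewrite !inE.
by case: (tail D e \in U); case: (tail D e \in W); case: (Defs.head D e \in U);
   case: (Defs.head D e \in W) => /=; lia.
Qed.

(** Hoffman's theorem.  The flow on one arc at a time is fixed to a value [k]
    that keeps the cut condition: the sets left by the arc bound [k] from
    below, those entered by it bound [k] from above, and submodularity of the
    cuts makes these bounds compatible.  When no freedom is left, the cut
    condition for a set and its complement gives equality. *)
Lemma feasible_flow (V A : finType) (D : digraph V A) (b : V -> int)
    (l u : A -> int) :
  \sum_v b v = 0 -> (forall a, l a <= u a) ->
  (forall U : {set V}, \sum_(v in U) b v <= cut_cap D l u U) ->
  exists y : A -> int, (forall a, l a <= y a <= u a) /\
    (forall U : {set V}, net_out D y U = \sum_(v in U) b v).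
Proof.
move=> b0; have [n] := ubnP #|[set a | l a != u a]|.
elim: n l u => // n IHn l u sz lu cut.
have [/existsP[a la]|/existsPn eqlu] := boolP [exists a, l a != u a];
  last first.
  have lE a : l a = u a by apply/eqP; have := eqlu a; rewrite negbK.
  exists l; split=> [a|U]; first by rewrite lexx lu.
  have capE W : cut_cap D l u W = net_out D l W.
    by rewrite /cut_cap; under eq_bigr do rewrite -lE.
  have complE (x : V -> int) :
      \sum_(v in U) x v + \sum_(v in ~: U) x v = \sum_v x v.
    rewrite -sum_setUI setICr setUCr big_set0 add0r.
    by apply: eq_bigl => v; rewrite inE.
  have cutU := cut U; have := cut (~: U).
  have netT : \sum_v net_out D l [set v]%SET = 0.
    rewrite -[RHS](net_outT D l) [RHS]net_out_sum.
    by apply: eq_bigl => v; rewrite inE.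
  have := complE b; have := complE (fun v => net_out D l [set v]%SET).
  rewrite -!net_out_sum b0 netT; move: cutU; rewrite !capE; lia.
pose bs (U : {set V}) := \sum_(v in U) b v.
have {}cut U : bs U <= cut_cap D l u U by apply: cut.
pose slack U := cut_cap D l u U - bs U.
(* Lowering [u a] to [k] takes [u a - k] from the slack of a set left by [a]. *)
pose k := \big[Order.max/l a]_(U : {set V} | a \in delta_out D U)
            (u a - slack U).
have lk : l a <= k by apply: bigmax_ge_id.
have ku : k <= u a.
  apply/bigmax_leP; split=> [|U _]; first exact: lu.
  by rewrite gerBl subr_ge0 cut.
pose l' e := if e == a then k else l e.
pose u' e := if e == a then k else u e.
have [|e|U|y [yb yU]] := IHn l' u'.
- rewrite -ltnS; apply: leq_trans sz; rewrite ltnS; apply: proper_card.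
  apply/properP; split.
    apply/subsetP => e; rewrite !inE /l' /u'; case: (e =P a) => // _.
    by rewrite eqxx.
  by exists a; rewrite !inE // /l' /u' !eqxx.
- by rewrite /l' /u'; case: (e =P a).
- rewrite -/(bs U); have -> : cut_cap D l' u' U = cut_cap D l u U
      + (a \in delta_out D U)%:R * (k - u a)
      - (a \in delta_in D U)%:R * (k - l a).
    rewrite !cut_capE !(bigD1 a (P := predT)) //= {1}/l' {1}/u' !eqxx.
    under eq_bigr => e /negPf ea do rewrite /l' /u' ea.
    ring.
  have [aU|aU] := boolP (a \in delta_out D U).
    have -> : (a \in delta_in D U) = false.
      by move: aU; rewrite !inE => /andP[->].
    have : u a - slack U <= k by apply: le_bigmax_cond.
    rewrite /slack; lia.
  have [aU'|aU'] := boolP (a \in delta_in D U); last by have := cut U; lia.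
  have : k <= slack U + l a.
    apply/bigmax_leP; split=> [|W aW].
      by rewrite lerDr subr_ge0 cut.
    have := cut_cap_submod lu aW aU'.
    have bWU : bs (W :&: U) + bs (W :|: U) = bs W + bs U by apply: sum_setUI.
    move: (cut (W :&: U)) (cut (W :|: U)) bWU; rewrite /slack; lia.
  rewrite /slack; lia.
exists y; split=> // e; have := yb e; rewrite /l' /u'; case: (e =P a) => // ->.
by case/andP => ky yk; rewrite (le_trans lk) ?(le_trans yk).
Qed.

(** Infinite capacities are replaced by a finite bound [K] so large that any cut
    containing an arc of infinite capacity still dominates every demand. *)
Lemma feasible_flow_ext (V A : finType) (D : digraph V A) (b : V -> int)
    (l u : A -> \bar int) :
  \sum_v b v = 0 ->
  (forall a, l a != +oo%E) -> (forall a, u a != -oo%E) ->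
  (forall a, (l a <= u a)%E) ->
  (forall U : {set V}, U != finset.setT -> U != finset.set0 ->
     ((\sum_(v in U) b v)%:E <=
        \sum_(a in delta_out D U) u a - \sum_(a in delta_in D U) l a)%E) ->
  exists y : A -> int,
    (forall a, (l a <= (y a)%:E)%E /\ ((y a)%:E <= u a)%E) /\
    (forall U : {set V}, net_out D y U = \sum_(v in U) b v).
Proof.
move=> b0 loo uoo lu cut.
pose m a : int := `|fine (l a)| + `|fine (u a)|.
pose K : int := \sum_v `|b v| + \sum_a m a.
have m_ge0 a : 0 <= m a by rewrite addr_ge0.
have mK a : m a <= K.
  rewrite ler_wpDl ?sumr_ge0 // (bigD1 a) //= lerDl; exact: sumr_ge0.
pose l' a : int := if l a == -oo%E then - K else fine (l a).
pose u' a : int := if u a == +oo%E then K else fine (u a).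
have lE a : l a != -oo%E -> l a = (l' a)%:E.
  by rewrite /l'; case: (l a) (loo a).
have uE a : u a != +oo%E -> u a = (u' a)%:E.
  by rewrite /u'; case: (u a) (uoo a).
have bK (U : {set V}) : \sum_(v in U) b v <= K - \sum_a m a.
  rewrite addrK (big_mkcond (fun v => v \in _)); apply: ler_sum => v _.
  by case: ifP => _; rewrite ?ler_norm.
have [a|U|y [yb yU]] := @feasible_flow V A D b l' u' b0.
- rewrite /l' /u'; move: (mK a) (lu a) (loo a) (uoo a); rewrite /m.
  by case: (l a) => [r||]; case: (u a) => [s||] //=; rewrite ?lee_fin; lia.
- have [->|UT] := eqVneq U finset.setT.
    have -> : \sum_(v in finset.setT) b v = 0.
      by rewrite -[RHS]b0; apply: eq_bigl => v; rewrite inE.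
    by rewrite cut_capE big1 // => a _; rewrite !inE !mul0r subrr.
  have [->|U0] := eqVneq U finset.set0.
    by rewrite big_set0 cut_capE big1 // => a _; rewrite !inE !mul0r subrr.
  pose oo a := (a \in delta_out D U) && (u a == +oo%E) ||
               (a \in delta_in D U) && (l a == -oo%E).
  have [/existsP[a aoo]|/existsPn nooo] := boolP [exists a, oo a].
    apply: (le_trans (bK U)); rewrite cut_capE.
    rewrite (bigD1 a) //= [leRHS](bigD1 a) //=.
    rewrite opprD addrA; apply: lerD.
      move: aoo (m_ge0 a) (mK a); rewrite /oo /l' /u' /m !inE.
      by case: (_ \in U); case: (_ \in U); rewrite //= ?orbF => /eqP->/=; lia.
    rewrite -sumrN; apply: ler_sum => e _; move: (mK e).
    rewrite /l' /u' /m !inE.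
    case: (tail D e \in U); case: (Defs.head D e \in U) => /=;
      case: ifP => _; case: ifP => _; lia.
  have outE : (\sum_(a in delta_out D U) u a =
               (\sum_(a in delta_out D U) u' a)%:E)%E.
    rewrite -sumEFin; apply: eq_bigr => a aU; apply: uE.
    by have := nooo a; rewrite /oo aU; case: eqP.
  have inE' : (\sum_(a in delta_in D U) l a =
               (\sum_(a in delta_in D U) l' a)%:E)%E.
    rewrite -sumEFin; apply: eq_bigr => a aU; apply: lE.
    by have := nooo a; rewrite /oo aU /= orbC; case: (l a).
  by have := cut U UT U0; rewrite outE inE' -EFinB lee_fin.
exists y; split=> // a; move: (yb a) (loo a) (uoo a); rewrite /l' /u'.
by case: (l a) => [r||] //; case: (u a) => [s||] //=;
  rewrite ?lee_fin ?leey ?leNye => /andP[].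
Qed.

Lemma net_out_dot (K : comPzRingType) (V A : finType) (D : digraph V A)
    (pi : V -> K) (y : A -> K) :
  \sum_v pi v * net_out D y [set v]%SET =
  \sum_a (pi (tail D a) - pi (Defs.head D a)) * y a.
Proof.
have sum1 w : \sum_v pi v * (w == v)%:R = pi w.
  rewrite (bigD1 w) //= eqxx mulr1 big1 ?addr0 // => v.
  by rewrite eq_sym => /negPf->; rewrite mulr0.
under eq_bigr do rewrite net_outE mulr_sumr.
rewrite exchange_big; apply: eq_bigr => a _ /=.
under eq_bigr do rewrite !inE mulrA mulrBr.
by rewrite -mulr_suml sumrB !sum1.
Qed.

(** * Integer cones of crossing families *)

(** Constants come with either sign: a vector that is paired with a member of
    the cone has a known total sum. *)
Definition in_cone (V : finType) (T : {set {set V}}) (g : V -> int) : Prop :=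
  exists (z : {set V} -> int) (t : int),
    (forall U, 0 <= z U /\ (z U != 0 -> U \in T)) /\
    (forall v, g v = \sum_U z U * (v \in U)%:R + t).

Lemma in_cone_const (V : finType) (T : {set {set V}}) (c : int) :
  in_cone T (fun=> c).
Proof.
exists (fun=> 0), c; split=> [U|v]; first by rewrite lexx eqxx.
by rewrite big1 ?add0r // => U _; rewrite mul0r.
Qed.

Lemma in_cone_set (V : finType) (T : {set {set V}}) (U : {set V}) :
  U \in T -> in_cone T (fun v => (v \in U)%:R).
Proof.
move=> UT; exists (fun W => (W == U)%:R), 0; split=> [W|v].
  by case: eqP => [->|].
rewrite addr0 (bigD1 U) //= eqxx mul1r big1 ?addr0 // => W /negPf->.
by rewrite mul0r.
Qed.

Lemma in_cone_add (V : finType) (T : {set {set V}}) (g h : V -> int) :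
  in_cone T g -> in_cone T h -> in_cone T (fun v => g v + h v).
Proof.
move=> [z [t [zP gE]]] [z' [t' [z'P hE]]].
exists (fun U => z U + z' U), (t + t'); split=> [U|v].
  have [z0 zT] := zP U; have [z'0 z'T] := z'P U; split; first exact: addr_ge0.
  have [zU0|/zT//] := eqVneq (z U) 0; by rewrite zU0 add0r => /z'T.
rewrite gE hE addrACA -big_split; congr (_ + _).
by apply: eq_bigr => U _; rewrite mulrDl.
Qed.

Lemma in_cone_sum (V I : finType) (T : {set {set V}}) (P : pred I)
    (g : I -> V -> int) :
  (forall i, P i -> in_cone T (g i)) ->
  in_cone T (fun v => \sum_(i | P i) g i v).
Proof.
move=> gT; elim: (index_enum I) => [|i r IHr].
  rewrite (_ : (fun _ => _) = fun=> 0); first exact: in_cone_const.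
  by apply/funext => v; rewrite big_nil.
have [Pi|/negPf Pi] := boolP (P i); last first.
  by rewrite (_ : (fun _ => _) = fun v => \sum_(j <- r | P j) g j v) //;
    apply/funext => v; rewrite big_cons Pi.
rewrite (_ : (fun _ => _) = fun v => g i v + \sum_(j <- r | P j) g j v).
  by apply: in_cone_add => //; apply: gT.
by apply/funext => v; rewrite big_cons Pi.
Qed.

(** The maximal members of such a family [G] are pairwise disjoint. *)
Lemma disjoint_cover (V : finType) (G : {set {set V}}) :
  (forall X Y, X \in G -> Y \in G -> X :&: Y != finset.set0 -> X :|: Y \in G) ->
  exists2 P : {set {set V}}, P \subset G &
    forall v, (v \in cover G)%:R = \sum_(X in P) (v \in X)%:R :> int.
Proof.
move=> GU; exists [set X | maxset [pred X in G] X].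
  by apply/subsetP => X; rewrite inE => /maxsetp.
move=> v; have [/bigcupP[X XG vX]|vG] := boolP (v \in cover G); last first.
  rewrite big1 // => X; rewrite inE => /maxsetp/= XG.
  by case: (boolP (v \in X)) => // vX; case/bigcupP: vG; exists X.
have [M Mmax /subsetP/(_ _ vX) vM] := maxset_exists (P := [pred X in G]) XG.
rewrite (bigD1 M) ?inE //= vM big1 ?addr0 // => M'.
rewrite inE => /andP[M'max M'M]; case: (boolP (v \in M')) => // vM'.
case/negP: M'M.
have UG : M' :|: M \in G.
  apply: GU; [exact: (maxsetp M'max)|exact: (maxsetp Mmax)|].
  by apply/finset.set0Pn; exists v; rewrite inE vM'.
have {1}<- := maxsetsup M'max UG (subsetUl _ _).
by rewrite (maxsetsup Mmax UG (subsetUr _ _)).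
Qed.

(** The set [Y] is the intersection of the members of [T] that contain it.  If
    the complements of two of these meet, then the two members cross, as they
    share the points of [Y]; so the complement of [Y] is a disjoint union of
    complements of members. *)
Lemma in_cone_bigcap (V : finType) (T : {set {set V}}) (Y : {set V}) :
  crossing_family T -> Y != finset.set0 ->
  (forall v, v \notin Y -> exists U, [/\ U \in T, Y \subset U & v \notin U]) ->
  in_cone T (fun v => (v \in Y)%:R).
Proof.
move=> Tcr Y0 Ycl.
pose G := [set X : {set V} | (~: X \in T) && (Y \subset ~: X)].
have [|P /subsetP PG Pcov] := @disjoint_cover V G.
  move=> X Z; rewrite !inE setCU => /andP[XT YX] /andP[ZT YZ] XZ.
  have YXZ : Y \subset ~: X :&: ~: Z by rewrite subsetI YX.
  rewrite YXZ andbT; apply: (Tcr _ _ XT ZT _).1; apply/andP; split.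
    apply: contraNneq Y0 => E; by rewrite -subset0 -E.
  by rewrite -setCI -finset.setC0 (inj_eq (can_inj (@finset.setCK V))).
have covG v : (v \in cover G) = (v \notin Y).
  apply/bigcupP/idP => [[X]|vY].
    rewrite inE => /andP[_ /subsetP YX] vX.
    by apply/negP => /YX; rewrite inE vX.
  have [U [UT YU vU]] := Ycl _ vY.
  by exists (~: U); rewrite ?inE ?finset.setCK ?UT.
have -> : (fun v => (v \in Y)%:R) =
    (fun v => \sum_(X in P) (v \in ~: X)%:R + (1 - #|P|%:R)) :> (V -> int).
  apply/funext => v.
  have -> : (v \in Y)%:R = 1 - (v \in cover G)%:R :> int.
    by rewrite covG; case: (v \in Y).
  rewrite Pcov.
  have <- : \sum_(X in P) (v \in X)%:R + \sum_(X in P) (v \in ~: X)%:R =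
      #|P|%:R :> int.
    rewrite -sum1_card natr_sum -big_split; apply: eq_bigr => X _ /=.
    by rewrite inE; case: (v \in X).
  ring.
apply: in_cone_add; last exact: in_cone_const.
by apply: in_cone_sum => X /PG; rewrite inE => /andP[XT _]; apply: in_cone_set.
Qed.

Definition hull (V : finType) (T : {set {set V}}) (v : V) : {set V} :=
  \bigcap_(U in T | v \in U) U.

Lemma in_hull (V : finType) (T : {set {set V}}) (v : V) : v \in hull T v.
Proof. by apply/finset.bigcapP => U /andP[]. Qed.

Lemma hull_sub (V : finType) (T : {set {set V}}) (U : {set V}) (v : V) :
  U \in T -> (hull T v \subset U) = (v \in U).
Proof.
move=> UT; apply/idP/idP => [/subsetP|vU]; first by apply; apply: in_hull.
by apply: finset.bigcap_inf; rewrite UT.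
Qed.

Lemma hull_mono (V : finType) (T : {set {set V}}) (u v : V) :
  u \in hull T v -> hull T u \subset hull T v.
Proof.
move=> /finset.bigcapP uv; apply/finset.bigcapsP => U /andP[UT vU].
by rewrite hull_sub // uv ?UT.
Qed.

Lemma notin_hull (V : finType) (T : {set {set V}}) (u v : V) :
  v \notin hull T u -> exists U, [/\ U \in T, u \in U & v \notin U].
Proof.
move=> vu; apply: contrapT => noU; case/negP: vu; apply/finset.bigcapP => U.
case/andP=> UT uU; apply: contrapT => /negP vU; apply: noU; by exists U.
Qed.

(** The nonempty intersections of members of [T] form an intersecting family,
    so the maximal ones inside [L] are disjoint; by separation they cover
    [L]. *)
Lemma in_cone_separated (V : finType) (T : {set {set V}}) (L : {set V}) :
  crossing_family T ->
  (forall u v, u \in L -> v \notin L ->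
     exists U, [/\ U \in T, u \in U & v \notin U]) ->
  in_cone T (fun v => (v \in L)%:R).
Proof.
move=> Tcr sepL.
pose cl (Y : {set V}) := [forall v, (v \notin Y) ==>
  [exists U in T, (Y \subset U) && (v \notin U)]].
have clP (Y : {set V}) v : cl Y -> v \notin Y ->
    exists U, [/\ U \in T, Y \subset U & v \notin U].
  move=> /forallP/(_ v)/implyP clY /clY /existsP[U /and3P[? ? ?]]; by exists U.
pose G := [set Y : {set V} | [&& Y != finset.set0, Y \subset L & cl Y]].
have [|P /subsetP PG Pcov] := @disjoint_cover V G.
  move=> Y Z; rewrite !inE => /and3P[Y0 YL clY] /and3P[_ ZL clZ] YZ.
  rewrite subUset YL ZL /=; apply/andP; split.
    by apply: contraNneq Y0 => E; rewrite -subset0 -E subsetUl.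
  apply/forallP => v; apply/implyP; rewrite inE negb_or => /andP[vY vZ].
  have [U [UT YU vU]] := clP _ _ clY vY; have [W [WT ZW vW]] := clP _ _ clZ vZ.
  have crUW : crossing_pair U W.
    apply/andP; split.
      by apply: contraNneq YZ => E; rewrite -subset0 -E setISS.
    by apply: contraTneq (in_setT v) => <-; rewrite inE negb_or vU.
  apply/existsP; exists (U :|: W).
  by rewrite (Tcr _ _ UT WT crUW).2 finset.setUSS //= inE negb_or vU.
have covG : cover G = L.
  apply/eqP; rewrite eqEsubset; apply/andP; split; apply/subsetP => u.
    by case/bigcupP => Y; rewrite inE => /and3P[_ /subsetP YL _] /YL.
  move=> uL; apply/bigcupP; exists (hull T u); last exact: in_hull.
  rewrite inE; apply/and3P; split.
  - by apply/finset.set0Pn; exists u; apply: in_hull.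
  - apply/subsetP => v vu; apply: contrapT => /negP vL.
    have [U [UT uU /negP]] := sepL _ _ uL vL; apply.
    by apply: subsetP vu; rewrite hull_sub.
  - apply/forallP => v; apply/implyP => /notin_hull[U [UT uU vU]].
    by apply/existsP; exists U; rewrite UT hull_sub // uU.
have -> : (fun v => (v \in L)%:R) =
    (fun v => \sum_(X in P) (v \in X)%:R) :> (V -> int).
  by apply/funext => v; rewrite -covG Pcov.
apply: in_cone_sum => Y /PG; rewrite inE => /and3P[Y0 _ clY].
by apply: in_cone_bigcap => // v; apply: clP.
Qed.

(** A function is, up to a constant, the sum of the indicators of its upper
    level sets; here these are separated. *)
Lemma in_cone_monotone (V : finType) (T : {set {set V}}) (g : V -> int) :
  crossing_family T ->
  (forall u v, (forall U, U \in T -> u \in U -> v \in U) -> g u <= g v) ->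
  in_cone T g.
Proof.
move=> Tcr gmon; pose M := \sum_v `|g v|.
have gM v : `|g v| <= M.
  by rewrite /M (bigD1 v) //= lerDl; apply: sumr_ge0.
pose h v := absz (g v + M).
have hE v : (h v)%:R = g v + M :> int by have := gM v; rewrite /h; lia.
pose N := absz (M + M).
have hN v : (h v <= N)%N by have := gM v; rewrite /h /N; lia.
have -> : g = (fun v => \sum_(k < N) (v \in [set v | (k < h v)%N])%:R + (- M)).
  apply/funext => v; apply/eqP; rewrite eq_sym subr_eq -hE; apply/eqP.
  under eq_bigr do rewrite inE.
  rewrite -natr_sum; congr (_%:R); rewrite -big_mkcond /=.
  by rewrite -(big_ord_widen N (fun=> 1%N)) // sum1_card card_ord.
apply: in_cone_add; last exact: in_cone_const.
apply: in_cone_sum => k _; apply: in_cone_separated => // u v; rewrite !inE.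
move=> ku kv; apply: contrapT => noU.
have : g u <= g v; last first.
  by rewrite -(lerD2r M) -!hE; move: ku kv; lia.
apply: gmon => U UT uU; apply: contrapT => /negP vU; apply: noU.
by exists U.
Qed.

Lemma sum_cone (K : comPzRingType) (V : finType) (x : V -> K) (g : V -> int)
    (z : {set V} -> int) (t : int) :
  (forall v, g v = \sum_U z U * (v \in U)%:R + t) ->
  \sum_v x v * (g v)%:~R =
  \sum_U (z U)%:~R * (\sum_(v in U) x v) + t%:~R * \sum_v x v.
Proof.
move=> gE.
under [\sum_v x v * _]eq_bigr => v _ do
  rewrite gE rmorphD rmorph_sum /= mulrDr [x v * t%:~R]mulrC mulr_sumr.
rewrite big_split /= -mulr_sumr exchange_big; congr (_ + _).
apply: eq_bigr => U _; rewrite mulr_sumr [RHS]big_mkcond; apply: eq_bigr => v _.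
rewrite rmorphM /= mulrCA.
by case: ifP => _; rewrite ?mulr1 ?mulr0.
Qed.

(** * Rounding with respect to two crossing families *)

Section Rounding.

Context (R : realType) (V : finType) (x : V -> R).

Lemma cone_sum_int (T : {set {set V}}) (L : {set V}) :
  (forall U, U \in T -> \sum_(v in U) x v \is a Num.int) ->
  \sum_v x v \is a Num.int ->
  in_cone T (fun v => (v \in L)%:R) -> \sum_(v in L) x v \is a Num.int.
Proof.
move=> xT xV [z [t [zP zE]]].
have -> : \sum_(v in L) x v = \sum_v x v * ((v \in L)%:R : int)%:~R.
  rewrite big_mkcond; apply: eq_bigr => v _.
  by case: ifP => _; rewrite ?mulr1 ?mulr0.
rewrite (sum_cone x zE); apply: rpredD; last by rewrite rpredM ?intr_int.
apply: rpred_sum => U _; have [->|zU] := eqVneq (z U) 0.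
  by rewrite mul0r rpred0.
by rewrite rpredM ?intr_int // xT //; apply: (zP U).2.
Qed.

(** A class of elements with the same hull is the difference of two separated
    sets: this hull, and the union of the smaller hulls inside it. *)
Lemma class_sum_int (T : {set {set V}}) (S : {set V}) :
  crossing_family T ->
  (forall U, U \in T -> \sum_(v in U) x v \is a Num.int) ->
  \sum_v x v \is a Num.int ->
  \sum_(v | hull T v == S) x v \is a Num.int.
Proof.
move=> Tcr xT xV.
have [/existsP[r /eqP rS]|/existsPn noS] := boolP [exists r, hull T r == S];
  last by rewrite big_pred0 ?rpred0 // => v; apply: negbTE.
have down (L : {set V}) : (forall u, u \in L -> hull T u \subset L) ->
    \sum_(v in L) x v \is a Num.int.
  move=> Ldown; apply: (cone_sum_int xT xV); apply: in_cone_separated => //.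
  move=> u v uL vL; apply: notin_hull.
  by apply: contraNN vL; apply: subsetP; apply: Ldown.
pose L := [set s in S | hull T s != S].
have SE : \sum_(v in S) x v = \sum_(v | hull T v == S) x v + \sum_(v in L) x v.
  rewrite (bigID (fun v => hull T v == S)) /=; congr (_ + _).
    apply: eq_bigl => v; case: eqP => [<-|]; rewrite ?andbF //.
    by rewrite in_hull.
  by apply: eq_bigl => v; rewrite inE.
have -> : \sum_(v | hull T v == S) x v = \sum_(v in S) x v - \sum_(v in L) x v.
  by rewrite SE addrK.
apply: rpredB; apply: down => u.
  by rewrite -rS => /hull_mono.
rewrite inE => /andP[uS uneS]; apply/subsetP => v vu.
have uS' : hull T u \subset S by rewrite -rS hull_mono // rS.
rewrite inE (subsetP uS') //=; apply: contraNneq uneS => vS.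
by rewrite eqEsubset uS' -vS hull_mono.
Qed.

(** Each element is an arc from its class for [T1] to its class for [T2]: a
    vector with given class sums is a flow with given net outflow, so an
    integral one exists as soon as a real one does. *)
Lemma integral_rounding (T1 T2 : {set {set V}}) :
  crossing_family T1 -> crossing_family T2 ->
  (forall U, U \in T1 -> \sum_(v in U) x v \is a Num.int) ->
  (forall U, U \in T2 -> \sum_(v in U) x v \is a Num.int) ->
  \sum_v x v \is a Num.int ->
  exists y : V -> int, forall U, U \in finset.setT |: (T1 :|: T2)%SET ->
    (\sum_(v in U) y v)%:~R = \sum_(v in U) x v.
Proof.
move=> T1cr T2cr xT1 xT2 xV.
pose D := Digraph (fun v => (true, hull T1 v)) (fun v => (false, hull T2 v)).
pose b n := Num.floor (net_out D x [set n]%SET).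
have bE n : (b n)%:~R = net_out D x [set n]%SET.
  apply/eqP; rewrite -intrEfloor net_outE.
  case: n => -[] S; under eq_bigr do rewrite !inE !xpair_eqE /= ?subr0 ?sub0r.
    rewrite (_ : \sum_v _ = \sum_(v | hull T1 v == S) x v).
      exact: class_sum_int.
    by rewrite [RHS]big_mkcond; apply: eq_bigr => v _; case: eqP;
      rewrite ?mul1r ?mul0r.
  rewrite (_ : \sum_v _ = - \sum_(v | hull T2 v == S) x v).
    by rewrite rpredN; apply: class_sum_int.
  by rewrite -sumrN [RHS]big_mkcond; apply: eq_bigr => v _; case: eqP;
    rewrite ?mulN1r ?oppr0 ?mul0r.
have bU (U : {set bool * {set V}}) : (\sum_(n in U) b n)%:~R = net_out D x U.
  by rewrite rmorph_sum net_out_sum /=; apply: eq_bigr => n _; apply: bE.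
have b0 : \sum_n b n = 0.
  apply/eqP; rewrite -(intr_eq0 R) -[X in _ == X](net_outT D x) -bU.
  by apply/eqP; congr (_%:~R); apply: eq_bigl => n; rewrite inE.
have [v|U|y [_ yU]] := @feasible_flow _ _ D b
    (fun v => Num.floor (x v))
    (fun v => Num.ceil (x v)) b0.
- by rewrite -(ler_int R) (le_trans (floor_le _)) ?ceil_ge.
- rewrite -(ler_int R) bU /cut_cap rmorphB !rmorph_sum /=.
  by apply: lerB; apply: ler_sum => v _; rewrite ?ceil_ge ?floor_le.
have yE U : net_out D (fun v => (y v)%:~R) U = net_out D x U.
  by rewrite net_out_int yU bU.
exists y => W; rewrite rmorph_sum /=.
have outE (U : {set bool * {set V}}) (c : R) :
    (forall v, (tail D v \in U)%:R - (Defs.head D v \in U)%:R =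
               c * (v \in W)%:R) ->
    c != 0 -> \sum_(v in W) (y v)%:~R = \sum_(v in W) x v.
  move=> UW c0; apply: (mulfI c0).
  have sumE (w : V -> R) : c * \sum_(v in W) w v = net_out D w U.
    rewrite net_outE mulr_sumr big_mkcond; apply: eq_bigr => v _.
    by rewrite UW; case: ifP => _; rewrite ?mulr1 ?mulr0 ?mul0r.
  by rewrite !sumE yE.
rewrite !inE => /or3P[/eqP WT|WT1|WT2].
- apply: (outE [set n | n.1]%SET 1) => [v|]; last exact: oner_neq0.
  by rewrite WT !inE subr0 mulr1.
- apply: (outE [set n : bool * {set V} | n.1 && (n.2 \subset W)]%SET 1) => [v|].
    by rewrite !inE /= hull_sub // subr0 mul1r.
  exact: oner_neq0.
- apply: (outE
    [set n : bool * {set V} | ~~ n.1 && (n.2 \subset W)]%SET (-1)) => [v|].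
    by rewrite !inE /= hull_sub // sub0r mulN1r.
  by rewrite oppr_eq0 oner_neq0.
Qed.
End Rounding.

(** * Rounding inside the polyhedron, keeping tight constraints tight *)

Lemma ord2_cases (i : 'I_2) : i = ord0 \/ i = ord_max.
Proof. by case: i => -[|[|//]] ?; [left|right]; apply: val_inj. Qed.

Definition dominated (K : numDomainType) (V : finType)
    (C : 'I_2 -> {set {set V}}) (f : 'I_2 -> {set V} -> int) (x : V -> K) :=
  forall (i : 'I_2) (U : {set V}), U \in C i ->
    \sum_(v in U) x v <= (f i U)%:~R.

Definition tight_sets (K : numDomainType) (V : finType)
    (C : {set {set V}}) (f : {set V} -> int) (x : V -> K) : {set {set V}} :=
  [set U in C | \sum_(v in U) x v == (f U)%:~R].

Lemma tight_setsP (K : numDomainType) (V : finType)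
    (C : {set {set V}}) (f : {set V} -> int) (x : V -> K) (U : {set V}) :
  reflect (U \in C /\ \sum_(v in U) x v = (f U)%:~R) (U \in tight_sets C f x).
Proof. by rewrite inE; apply: (iffP andP) => -[UC /eqP]. Qed.

Lemma tight_sets_crossing (K : numDomainType) (V : finType)
    (C : {set {set V}}) (f : {set V} -> int) (x : V -> K) :
  crossing_family C -> crossing_submodular C f ->
  (forall U, U \in C -> \sum_(v in U) x v <= (f U)%:~R) ->
  crossing_family (tight_sets C f x).
Proof.
move=> Ccr fsub xf U W /tight_setsP[UC xU] /tight_setsP[WC xW] cr.
have [IC JC] := Ccr _ _ UC WC cr.
have := fsub _ _ UC WC cr; rewrite -(ler_int K) !rmorphD /= -xU -xW -sum_setUI.
move=> le; have := lerD (xf _ IC) (xf _ JC) => ge.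
have eqs : \sum_(v in U :&: W) x v + \sum_(v in U :|: W) x v =
    (f (U :&: W))%:~R + (f (U :|: W))%:~R by apply/eqP; rewrite eq_le ge le.
split; apply/tight_setsP; split=> //; apply/eqP; rewrite eq_le xf //=.
  by rewrite -(lerD2r (\sum_(v in U :|: W) x v)) eqs lerD2l xf.
by rewrite -(lerD2l (\sum_(v in U :&: W) x v)) eqs lerD2r xf.
Qed.

(** Rounding with respect to the tight sets gives an integral point [y] of the
    smallest affine space defined by tight constraints; if [y] violates some
    constraint, the segment from [x] to [y] leaves the polyhedron at a point
    where more constraints are tight. *)
Lemma integral_dominated (R : realType) (V : finType)
    (C : 'I_2 -> {set {set V}}) (f : 'I_2 -> {set V} -> int) (x : V -> R) :
  (forall i, crossing_family (C i)) ->
  (forall i, crossing_submodular (C i) (f i)) ->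
  dominated C f x -> \sum_v x v \is a Num.int ->
  exists y : V -> int, [/\ dominated C f y,
    forall i U, U \in tight_sets (C i) (f i) x -> \sum_(v in U) y v = f i U &
    (\sum_v y v)%:~R = \sum_v x v].
Proof.
move=> Ccr fsub.
pose loose (x : V -> R) :=
  [set r | (r.2 \in C r.1) && (r.2 \notin tight_sets (C r.1) (f r.1) x)].
have looseE z s : (s \in loose z) =
    (s.2 \in C s.1) && (s.2 \notin tight_sets (C s.1) (f s.1) z).
  by rewrite in_set.
have [n] := ubnP #|loose x|; elim: n x => // n IHn x sz xf xV.
have Tcr i : crossing_family (tight_sets (C i) (f i) x).
  by apply: tight_sets_crossing => // U; apply: xf.
have xT i U : U \in tight_sets (C i) (f i) x -> \sum_(v in U) x v \is a Num.int.
  by case/tight_setsP => _ ->.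
have [y yx] := integral_rounding (Tcr ord0) (Tcr ord_max) (@xT _) (@xT _) xV.
have yV : (\sum_v y v)%:~R = \sum_v x v.
  have inT : \sum_v y v = \sum_(v in finset.setT) y v.
    by apply: eq_bigl => v; rewrite inE.
  by rewrite inT yx ?setU11 //; apply: eq_bigl => v; rewrite inE.
have yT i U : U \in tight_sets (C i) (f i) x -> \sum_(v in U) y v = f i U.
  move=> UT; apply/eqP; rewrite -(eqr_int R) yx.
    by case/tight_setsP: UT => _ ->.
  by rewrite !in_setU; case: (ord2_cases i) UT => -> ->; rewrite ?orbT.
pose bad (r : 'I_2 * {set V}) :=
  (r.2 \in C r.1) && (f r.1 r.2 < \sum_(v in r.2) y v).
have [/existsP[r0 bad0]|/existsPn good] := boolP [exists r, bad r]; last first.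
  exists y; split=> // i U UC; have := good (i, U).
  by rewrite /bad /= UC /= -leNgt intz.
pose X (U : {set V}) := \sum_(v in U) x v.
pose Y (U : {set V}) : R := (\sum_(v in U) y v)%:~R.
pose ratio (r : 'I_2 * {set V}) := ((f r.1 r.2)%:~R - X r.2) / (Y r.2 - X r.2).
have [r badr rmin] : {r | bad r & forall s, bad s -> ratio r <= ratio s}.
  by case: (arg_minP ratio bad0) => r ? ?; exists r.
have badP s : bad s -> X s.2 <= (f s.1 s.2)%:~R < Y s.2.
  by case/andP => sC; rewrite -(ltr_int R) => ->; rewrite andbT; apply: xf.
pose lam := ratio r.
have [lam0 lam1] : 0 <= lam /\ lam < 1.
  have := badP _ badr => /andP[? ?]; rewrite /lam /ratio.
  by rewrite divr_ge0 ?ltr_pdivrMr //; lra.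
pose x' v := x v + lam * ((y v)%:~R - x v).
have x'E (U : {set V}) : \sum_(v in U) x' v = X U + lam * (Y U - X U).
  by rewrite big_split /= -mulr_sumr sumrB /X /Y rmorph_sum.
have x'tight s : s.2 \in tight_sets (C s.1) (f s.1) x ->
    s.2 \in tight_sets (C s.1) (f s.1) x'.
  move=> sT; have /tight_setsP[sC sx] := sT; apply/tight_setsP; split=> //.
  by rewrite x'E /X /Y (yT _ _ sT) sx subrr mulr0 addr0.
have [|||z [zf zT zV]] := IHn x'.
- rewrite -ltnS; apply: leq_trans sz; rewrite ltnS; apply: proper_card.
  apply/properP; split.
    apply/subsetP => s; rewrite !looseE => /andP[-> sx'] /=.
    exact: contraNN (@x'tight s) sx'.
  have /andP[rC ry] := badr; have /andP[Xr Yr] := badP _ badr.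
  exists r; rewrite looseE rC /=; last first.
    have YX : Y r.2 - X r.2 != 0.
      by rewrite subr_eq0 gt_eqF // (le_lt_trans Xr).
    rewrite negbK; apply/tight_setsP; split; first exact: rC.
    by rewrite x'E /lam /ratio (divfK YX) addrC subrK.
  by apply: contraTN ry => /yT ->; rewrite ltxx.
- move=> i U UC; rewrite x'E; have := xf i U UC; rewrite -/(X U) => XU.
  have [bU|] := boolP (bad (i, U)).
    have := badP _ bU => /andP[/= _ fY]; have := rmin _ bU.
    rewrite -/lam {1}/ratio /= ler_pdivlMr ?subr_gt0 ?(le_lt_trans XU) //; lra.
  rewrite /bad /= UC /= -leNgt -(ler_int R) -/(Y U) => YU.
  have : 0 <= (1 - lam) * ((f i U)%:~R - X U) + lam * ((f i U)%:~R - Y U).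
    by rewrite addr_ge0 // mulr_ge0 ?subr_ge0 // ltW.
  clear; lra.
- rewrite (_ : \sum_v x' v = \sum_v x v) //.
  rewrite big_split /= -mulr_sumr sumrB -rmorph_sum /=.
  by rewrite yV subrr mulr0 addr0.
exists z; split=> // [i U UT|].
  by apply: zT; apply: (x'tight (i, U)).
rewrite zV big_split /= -mulr_sumr sumrB -rmorph_sum /=.
by rewrite yV subrr mulr0 addr0.
Qed.

(** * Integral potentials *)

Section Potential.
Context (V A : finType) (D : digraph V A) (P : pred A) (len : A -> int).

Fixpoint walk (x : V) (s : seq A) (y : V) : bool :=
  if s is a :: s' then [&& P a, tail D a == x & walk (Defs.head D a) s' y]
  else x == y.

Definition walk_len (s : seq A) : int := \sum_(a <- s) len a.

Lemma walk_cat x s t y :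
  walk x (s ++ t) y <-> exists2 z, walk x s z & walk z t y.
Proof.
elim: s x => [|a s IHs] x /=.
  by split=> [w|[z /eqP-> //]]; exists x.
split=> [/and3P[-> -> /IHs]//|[z /and3P[-> -> w] w']].
by apply/IHs; exists z.
Qed.

Lemma sum_count (F : A -> int) (s : seq A) :
  \sum_a F a * (count_mem a s)%:Z = \sum_(a <- s) F a.
Proof.
elim: s => [|a s IHs]; first by rewrite big_nil big1 // => a _; rewrite mulr0.
rewrite big_cons -IHs; under eq_bigr do rewrite /= PoszD mulrDr.
rewrite big_split /=; congr (_ + _).
rewrite (bigD1 a) //= eqxx mulr1 big1 ?addr0 // => b.
by rewrite eq_sym => /negPf->; rewrite mulr0.
Qed.

Hypothesis circ_ge0 : forall n : A -> nat, (forall a, (0 < n a)%N -> P a) ->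
  (forall v, net_out D (fun a => (n a)%:Z) [set v]%SET = 0) ->
  0 <= \sum_a len a * (n a)%:Z.

Lemma closed_walk_ge0 x s : walk x s x -> 0 <= walk_len s.
Proof.
move=> w; rewrite /walk_len -sum_count; apply: circ_ge0 => [a|v].
  rewrite -has_count => /hasP[b bs /eqP<-].
  elim: s {1}x w bs => // c s IHs y /= /and3P[Pc _ w].
  by rewrite inE => /predU1P[->|/(IHs _ w)].
have netE y : walk x s y ->
    net_out D (fun a => (count_mem a s)%:Z) [set v]%SET =
    (x == v)%:R - (y == v)%:R.
  rewrite net_outE sum_count; elim: s {w} x => [|a s IHs] z /=.
    by rewrite big_nil => /eqP->; rewrite subrr.
  case/and3P=> _ /eqP<- w; rewrite big_cons (IHs _ w) !inE; ring.
by rewrite (netE _ w) subrr.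
Qed.

Lemma not_uniqE (T : eqType) (s : seq T) :
  ~~ uniq s -> exists a s1 s2 s3, s = s1 ++ a :: s2 ++ a :: s3.
Proof.
elim: s => //= a s IHs; rewrite negb_and negbK.
case/orP => [/path.splitPr[s2 s3]|/IHs].
  by exists a, [::], s2, s3.
by move=> [b [s1 [s2 [s3 ->]]]]; exists b, (a :: s1), s2, s3.
Qed.

(** Cutting out a closed part of a walk does not increase its length. *)
Lemma walk_len_bounded x s y :
  walk x s y -> - \sum_a `|len a| <= walk_len s.
Proof.
have [n] := ubnP (size s); elim: n s => // n IHn s; rewrite ltnS => sz w.
have [us|/not_uniqE[a [s1 [s2 [s3 sE]]]]] := boolP (uniq s).
  have -> : walk_len s = \sum_(a in s) len a by apply: big_uniq.
  rewrite lerNl -sumrN big_mkcond; apply: ler_sum => a _ /=.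
  by case: ifP => _; rewrite // -normrN ler_norm.
move: w; rewrite sE => /walk_cat[z w1 /(@walk_cat z (a :: s2))[z' w2 w3]].
have := w3; rewrite /= => /and3P[_ /eqP zz' _].
have := w2; rewrite /= => /and3P[_ /eqP zz _].
rewrite -zz' in w2 w3; rewrite -zz in w1 w2 w3.
have : - \sum_a `|len a| <= walk_len (s1 ++ a :: s3).
  apply: IHn; last by apply/walk_cat; exists (tail D a).
  by apply: leq_trans sz; rewrite sE !size_cat /= size_cat /=; lia.
have -> : walk_len (s1 ++ a :: s2 ++ a :: s3) =
    walk_len (s1 ++ a :: s3) + walk_len (a :: s2).
  by rewrite /walk_len !big_cat /= !big_cons big_cat /= big_cons; ring.
by move=> le; rewrite ler_wpDr //; apply: closed_walk_ge0 w2.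
Qed.

Lemma ex_min_int (Q : int -> Prop) (m : int) :
  (exists k, Q k) -> (forall k, Q k -> m <= k) ->
  exists k, Q k /\ forall k', Q k' -> k <= k'.
Proof.
move=> [k0 Qk0] Qm.
have exQ : exists n : nat, `[< Q (m + n%:Z) >].
  exists (absz (k0 - m)); apply/asboolP.
  by rewrite (_ : m + _ = k0) //; have := Qm _ Qk0; lia.
case: (ex_minnP exQ) => n /asboolP Qn nmin; exists (m + n%:Z); split=> // k Qk.
have mk := Qm _ Qk; have := nmin (absz (k - m)) => nle.
suff : (n <= absz (k - m))%N by lia.
by apply: nle; apply/asboolP; rewrite (_ : m + _ = k) //; lia.
Qed.

(** The length of a shortest walk ending at a given node is a potential. *)
Lemma potential_exists :
  exists p : V -> int,
    forall a, P a -> p (Defs.head D a) <= p (tail D a) + len a.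
Proof.
pose Q v k := exists x s, walk x s v /\ k = walk_len s.
have /boolp.choice[p pP] :
    forall v, exists k, Q v k /\ forall k', Q v k' -> k <= k'.
  move=> v.
  apply: (@ex_min_int _ (- \sum_a `|len a|)).
    by exists 0, v, [::]; rewrite /walk_len big_nil /= eqxx.
  by move=> _ [x [s [w ->]]]; apply: walk_len_bounded w.
exists p => a Pa; have [[x [s [w ->]]] _] := pP (tail D a).
apply: (pP (Defs.head D a)).2; exists x, (s ++ [:: a]); split.
  by apply/walk_cat; exists (tail D a); rewrite //= Pa !eqxx.
by rewrite /walk_len big_cat /= big_cons big_nil addr0.
Qed.

End Potential.

(** * An integral Farkas lemma for two crossing families *)

(** A splitting [pi = p + (pi - p)] into two functions that are monotone for
    [T1] and for [T2] amounts to difference constraints on [p].  A circulation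
    in the corresponding digraph yields the direction [d] carried by the arcs
    of the second kind: these never increase a member of [T2], and since the
    arcs of the first kind carry [- d], they never increase a member of [T1]. *)
Lemma cone_two_families (V : finType) (T1 T2 : {set {set V}}) (pi : V -> int) :
  crossing_family T1 -> crossing_family T2 ->
  (forall d : V -> int, \sum_v d v = 0 ->
     (forall U, U \in T1 :|: T2 -> \sum_(v in U) d v <= 0) ->
     \sum_v pi v * d v <= 0) ->
  exists g1 g2 : V -> int, [/\ in_cone T1 g1, in_cone T2 g2 &
    forall v, pi v = g1 v + g2 v].
Proof.
move=> T1cr T2cr dirP.
(* The arc [(true, (a, b))] stands for [p b <= p a], and [(false, (a, b))] for
   [(pi - p) a <= (pi - p) b]. *)
pose D := Digraph (fun e : bool * (V * V) => e.2.1) (fun e => e.2.2).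
pose P (e : bool * (V * V)) :=
  if e.1 then e.2.1 \in hull T1 e.2.2 else e.2.2 \in hull T2 e.2.1.
pose len (e : bool * (V * V)) : int := if e.1 then 0 else pi e.2.2 - pi e.2.1.
have hullP (T : {set {set V}}) u v U :
    v \in hull T u -> U \in T -> (u \in U)%:R <= (v \in U)%:R :> int.
  move=> /finset.bigcapP vu UT; have [uU|//] := boolP (u \in U).
  by rewrite vu ?UT.
have [|p pP] := @potential_exists _ _ D P len.
  move=> n nP n0; pose n2 e : int := if e.1 then 0 else (n e)%:Z.
  have n0U U : net_out D (fun e => (n e)%:Z) U = 0.
    by rewrite net_out_sum big1.
  have := dirP (fun v => net_out D n2 [set v]%SET).
  rewrite net_out_dot.
  rewrite (_ : \sum_a _ * n2 a = - \sum_a len a * (n a)%:Z); last first.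
    rewrite -sumrN; apply: eq_bigr => -[[] [a b]] _; rewrite /n2 /len /=; ring.
  rewrite oppr_le0; apply=> [|U].
    transitivity (net_out D n2 finset.setT); last exact: net_outT.
    by rewrite [RHS]net_out_sum; apply: eq_bigl => v; rewrite inE.
  rewrite -net_out_sum inE => /orP[UT1|UT2].
    have -> : net_out D n2 U = net_out D n2 U - net_out D (fun e => (n e)%:Z) U.
      by rewrite n0U subr0.
    rewrite !net_outE -sumrB.
    apply: sumr_le0 => -[[] [a b]] _; rewrite /n2 /=; last by rewrite subrr.
    have [->|] := posnP (n (true, (a, b))); first by rewrite mulr0 subrr.
    move=> npos; have := hullP _ _ _ _ (nP _ npos) UT1; rewrite /=; nia.
  rewrite net_outE; apply: sumr_le0 => -[[] [a b]] _; rewrite /n2 /=.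
    by rewrite mulr0.
  have [->|npos] := posnP (n (false, (a, b))); first by rewrite mulr0.
  have := hullP _ _ _ _ (nP _ npos) UT2; rewrite /=; nia.
have hullI (T : {set {set V}}) u v :
    (forall U, U \in T -> u \in U -> v \in U) -> v \in hull T u.
  by move=> uv; apply/finset.bigcapP => U /andP[]; apply: uv.
exists p, (fun v => pi v - p v); split=> [||v]; last by rewrite addrC subrK.
  apply: in_cone_monotone => // u v uv.
  by have := pP (true, (v, u)); rewrite /P /len /= addr0; apply; apply: hullI.
apply: in_cone_monotone => // u v uv.
have := pP (false, (u, v)); rewrite /P /len /= => /(_ (hullI _ _ _ uv)); lia.
Qed.

(** * Optimal points and feasible directions *)

Lemma small_step (K : realFieldType) (I : finType) (P : pred I) (a c : I -> K) :
  (forall i, P i -> 0 <= a i) -> (forall i, P i -> a i = 0 -> c i <= 0) ->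
  exists2 e : K, 0 < e & forall i, P i -> e * c i <= a i.
Proof.
move=> a0 c0; pose q i := a i / (`|c i| + 1).
have c1 i : 0 < `|c i| + 1 by rewrite ltr_wpDl.
exists (\big[Order.min/1]_(i | P i && (0 < a i)) q i) => [|i Pi].
  by apply/bigmin_gtP; split=> // i /andP[_ ai]; rewrite divr_gt0.
set e := \big[_/_]_(_ | _) _.
have e0 : 0 <= e.
  by apply/bigmin_geP; split=> // j /andP[_ aj]; rewrite divr_ge0 ?ltW.
have [ai0|ai0] := eqVneq (a i) 0.
  by rewrite ai0 mulr_ge0_le0 // c0.
have aipos : 0 < a i by rewrite lt0r ai0 a0.
have : e <= q i by apply: bigmin_le_cond; rewrite Pi.
rewrite /q ler_pdivlMr // => eq; apply: le_trans eq.
by rewrite ler_wpM2l // (le_trans (ler_norm _)) // lerDl.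
Qed.

Lemma complementary_slackness (R : realType) (I J : finType)
    (B : I -> J -> rat) (b : I -> rat) (w x : {ffun J -> R})
    (z : {ffun I -> R}) :
  solutions R B b x -> dual_solutions B w z ->
  (forall i, z i != 0 -> \sum_j ratr (B i j) * x j = ratr (b i)) ->
  is_minimizer (dual_solutions B w) (dotp [ffun i => ratr (b i)]) z.
Proof.
move=> xP zP slack; split=> // z' z'P.
have valE (s : {ffun I -> R}) : dual_solutions B w s ->
    \sum_i s i * (\sum_j ratr (B i j) * x j) = dotp w x.
  case=> _ sB; under eq_bigr do rewrite mulr_sumr.
  rewrite exchange_big; apply: eq_bigr => j _ /=.
  by rewrite -sB mulr_suml; apply: eq_bigr => i _; rewrite mulrA.
apply: (@le_trans _ _ (dotp w x)).
  rewrite -(valE _ zP) /dotp le_eqVlt; apply/orP; left; apply/eqP.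
  apply: eq_bigr => i _; rewrite ffunE mulrC.
  by have [->|/slack->//] := eqVneq (z i) 0; rewrite !mul0r.
rewrite -(valE _ z'P); apply: ler_sum => i _; rewrite ffunE [leRHS]mulrC.
by apply: ler_wpM2l; [apply: z'P.1|apply: xP].
Qed.

Lemma le_min_ext (V : finType) (C : 'I_2 -> {set {set V}})
    (f : 'I_2 -> {set V} -> int) (U : {set V}) (m : int) :
  (forall i, U \in C i -> m <= f i U) -> (m%:E <= min_ext C f U)%E.
Proof.
move=> mf; rewrite /min_ext; elim/big_ind: _ => [|a b|i _]; first exact: leey.
  by move=> ma mb; rewrite le_min ma.
by rewrite /extend_oo; case: ifP => [/mf|_]; rewrite ?leey ?lee_fin.
Qed.

Lemma min_ext_le0 (V : finType) (C : 'I_2 -> {set {set V}})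
    (f : 'I_2 -> {set V} -> int) (U : {set V}) :
  (min_ext C f U <= 0%:E)%E -> exists2 i, U \in C i & f i U <= 0.
Proof.
move=> le0; apply: contrapT => no.
suff : (1%:E <= min_ext C f U)%E by move=> /le_trans/(_ le0); rewrite lee_fin.
apply: le_min_ext => i UC; rewrite -[1]add0r lezD1 ltNge.
by apply/negP => fU; apply: no; exists i.
Qed.

Lemma unbounded_cut (V A : finType) (D : digraph V A) (U : {set V})
    (m : \bar int) :
  (delta_out D U = finset.set0 -> delta_in D U = finset.set0 -> (m <= 0)%E) ->
  (m <= \sum_(a in delta_out D U) +oo%E - \sum_(a in delta_in D U) -oo%E)%E.
Proof.
have sum_pos (B : {set A}) : B != finset.set0 ->
    (\sum_(a in B) +oo%E = +oo%E :> \bar int)%E.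
  case/finset.set0Pn => a aB; apply/eqP; rewrite esum_eqy //.
  by apply/existsP; exists a; rewrite aB.
have sum_neg (B : {set A}) : B != finset.set0 ->
    (\sum_(a in B) -oo%E = -oo%E :> \bar int)%E.
  case/finset.set0Pn => a aB; apply/eqP; rewrite esum_eqNy //.
  by apply/existsP; exists a; rewrite aB.
have [-> | out0] := eqVneq (delta_out D U) finset.set0;
  have [-> | in0] := eqVneq (delta_in D U) finset.set0.
- by rewrite !big_set0 sube0; apply.
- by rewrite big_set0 sum_neg // leey.
- by rewrite big_set0 sum_pos // leey.
- by rewrite sum_pos ?sum_neg // leey.
Qed.

Section FlowPolyhedron.
Context (R : realType) (V A : finType) (D : digraph V A).
Context (C : 'I_2 -> {set {set V}}) (f : 'I_2 -> {set V} -> int).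

Definition excess (y : A -> R) (v : V) : R := net_out D y [set v]%SET.

Lemma sum_excess (y : A -> R) (U : {set V}) :
  \sum_(v in U) excess y v = net_out D y U.
Proof. by rewrite net_out_sum. Qed.

Lemma sum_excessT (y : A -> R) : \sum_v excess y v = 0.
Proof.
transitivity (\sum_(v in finset.setT) excess y v).
  by apply: eq_bigl => v; rewrite inE.
by rewrite sum_excess net_outT.
Qed.

Lemma flow_dominated (y : {ffun A -> R}) :
  flow_polyhedron R D C f y <-> dominated C f (excess y).
Proof.
by split=> yP i U UC; have := yP i U UC; rewrite sum_excess.
Qed.

Definition tight (y : {ffun A -> R}) (i : 'I_2) : {set {set V}} :=
  tight_sets (C i) (f i) (excess y).

(** A direction that does not increase any tight constraint can be followed
    for a small step. *)
Lemma optimal_direction (c y z : {ffun A -> R}) :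
  is_maximizer (flow_polyhedron R D C f) (dotp c) y ->
  (forall i U, U \in tight y i -> net_out D z U <= 0) -> dotp c z <= 0.
Proof.
move=> [yP ymax] zT.
pose P (r : 'I_2 * {set V}) := r.2 \in C r.1.
have [r Pr|r Pr|e e0 eP] := @small_step R _ P
    (fun r => (f r.1 r.2)%:~R - net_out D y r.2) (fun r => net_out D z r.2).
- by rewrite subr_ge0; apply: yP.
- move/eqP; rewrite subr_eq0 => /eqP ryf; apply: (zT r.1).
  by apply/tight_setsP; rewrite sum_excess ryf.
have := ymax [ffun a => y a + e * z a].
have -> : dotp c [ffun a => y a + e * z a] = dotp c y + e * dotp c z.
  rewrite /dotp mulr_sumr -big_split; apply: eq_bigr => a _ /=.
  by rewrite ffunE mulrDr mulrCA.
rewrite gerDl pmulr_rle0 //; apply=> i U UC.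
have := eP (i, U) UC; rewrite lerBrDr addrC; apply: le_trans.
rewrite -[leLHS]/(net_out D _ U) !net_outE mulr_sumr -big_split /=.
rewrite le_eqVlt; apply/orP; left; apply/eqP/eq_bigr => a _.
by rewrite ffunE mulrDr [in RHS]mulrCA.
Qed.


(** * Flows on a face and integral dual solutions *)

Hypothesis hC : forall i : 'I_2, crossing_family (C i).
Hypothesis hf : forall i : 'I_2, crossing_submodular (C i) (f i).

Lemma tight_crossing (y : {ffun A -> R}) (i : 'I_2) :
  flow_polyhedron R D C f y -> crossing_family (tight y i).
Proof.
move=> /flow_dominated yf; apply: tight_sets_crossing => // U; exact: yf.
Qed.

(** An integral vector dominated by [f], tight wherever the excess of a point
    of the face is, is the excess of an integral flow within the bounds; moving
    away from it stays feasible for a while, so it lies on the face. *)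
Lemma face_integral_point (l u : A -> \bar int) (F : set {ffun A -> R}) :
  (forall a, l a != +oo%E) -> (forall a, u a != -oo%E) ->
  (forall a, (l a <= u a)%E) ->
  (forall U : {set V}, U != finset.setT -> U != finset.set0 ->
     (min_ext C f U <=
        \sum_(a in delta_out D U) u a - \sum_(a in delta_in D U) l a)%E) ->
  face (flow_polyhedron R D C f) F -> (exists y, F y) ->
  exists y : {ffun A -> int}, F (int_point R y) /\
    (forall a, (l a <= (y a)%:E)%E /\ ((y a)%:E <= u a)%E).
Proof.
move=> loo uoo lu cut [c [d [cd FE]]] [y0 /FE[y0P y0d]].
have [||x [xf xT xV]] := integral_dominated hC hf (x := excess y0).
- exact/flow_dominated.
- by rewrite sum_excessT rpred0.
have x0 : \sum_v x v = 0.
  by apply/eqP; rewrite -(intr_eq0 R) xV sum_excessT.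
have [U UT U0|y [ylu yx]] := feasible_flow_ext (D := D) x0 loo uoo lu.
  apply: le_trans (cut U UT U0); apply: le_min_ext => i UC.
  by have := xf i U UC; rewrite intz.
exists (finfun y); split; last by move=> a; rewrite ffunE; apply: ylu.
have yE U : net_out D (int_point R (finfun y)) U = (\sum_(v in U) x v)%:~R.
  by rewrite -yx -net_out_int !net_outE; apply: eq_bigr => a _; rewrite !ffunE.
have yP : flow_polyhedron R D C f (int_point R (finfun y)).
  move=> i U UC; rewrite -[leLHS]/(net_out D _ U) yE ler_int.
  by have := xf i U UC; rewrite intz.
apply/FE; split=> //; apply/eqP; rewrite eq_le cd //=.
have y0max : is_maximizer (flow_polyhedron R D C f) (dotp c) y0.
  by split=> // y' /cd; rewrite y0d.
pose z := [ffun a => y0 a - int_point R (finfun y) a].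
have := optimal_direction (z := z) y0max.
have -> : dotp c z =
    dotp c y0 - dotp c (int_point R (finfun y)).
  by rewrite /dotp -sumrB; apply: eq_bigr => a _; rewrite [in LHS]ffunE mulrBr.
rewrite y0d subr_le0; apply=> i U UT.
have -> : net_out D z U =
    net_out D y0 U - net_out D (int_point R (finfun y)) U.
  rewrite !net_outE -sumrB; apply: eq_bigr => a _.
  by rewrite [in LHS]ffunE mulrBr.
by rewrite yE (xT i) // subr_le0 -sum_excess; have /tight_setsP[_ ->] := UT.
Qed.

(** A maximized objective vanishes on all circulations, hence is a potential
    difference. *)
Lemma optimal_potential (w : {ffun A -> int}) (y : {ffun A -> R}) :
  is_maximizer (flow_polyhedron R D C f) (dotp (int_point R w)) y ->
  exists pi : V -> int, forall a, w a = pi (tail D a) - pi (Defs.head D a).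
Proof.
move=> ymax.
(* Each arc occurs in both directions, which turns the inequalities for a
   potential into equalities. *)
pose D' := Digraph
  (fun e : A * bool => if e.2 then tail D e.1 else Defs.head D e.1)
  (fun e : A * bool => if e.2 then Defs.head D e.1 else tail D e.1).
pose len (e : A * bool) := if e.2 then - w e.1 else w e.1.
have [|p pP] := @potential_exists _ _ D' predT len; last first.
  exists p => a; apply/eqP; rewrite eq_le.
  have := pP (a, true) isT; have := pP (a, false) isT; rewrite /len /=; lia.
have sum_bool (F : A * bool -> int) :
    \sum_e F e = \sum_a (F (a, true) + F (a, false)).
  transitivity (\sum_a \sum_b F (a, b)).
    by rewrite pair_bigA; apply: eq_bigr => -[].
  by apply: eq_bigr => a _; rewrite big_bool.
move=> n _ n0; pose z := [ffun a => (n (a, true))%:Z - (n (a, false))%:Z].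
have := optimal_direction (z := int_point R z) ymax.
have -> : dotp (int_point R w) (int_point R z) =
    (- \sum_e len e * (n e)%:Z)%:~R.
  rewrite /dotp sum_bool -sumrN rmorph_sum; apply: eq_bigr => a _ /=.
  rewrite /len !ffunE -rmorphM /=; congr (_%:~R); ring.
rewrite lerz0 oppr_le0; apply=> i U _.
rewrite (_ : net_out D _ U = 0) //.
have -> : net_out D (int_point R z) U = (net_out D' (fun e => (n e)%:Z) U)%:~R.
  rewrite !net_outE sum_bool rmorph_sum; apply: eq_bigr => a _ /=.
  rewrite !ffunE; case: (tail D a \in U); case: (Defs.head D a \in U) => /=;
    rewrite rmorphB ?rmorphD !rmorphM !rmorphB /=; ring.
by rewrite net_out_sum big1.
Qed.

Hypothesis h0 : forall U : {set V}, U != finset.setT -> U != finset.set0 ->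
  delta_out D U = finset.set0 -> delta_in D U = finset.set0 ->
  (min_ext C f U <= 0%:E)%E.

(** A set without incident arcs has excess 0, so by hypothesis it is tight;
    hence a vector that does not increase tight sets is the excess of a flow. *)
Lemma tight_flow (y : {ffun A -> R}) (d : V -> int) :
  flow_polyhedron R D C f y -> \sum_v d v = 0 ->
  (forall i U, U \in tight y i -> \sum_(v in U) d v <= 0) ->
  exists z : {ffun A -> int}, forall U, net_out D z U = \sum_(v in U) d v.
Proof.
move=> yP d0 dT.
have [|||U UT U0|z [_ zd]] := @feasible_flow_ext _ _ D d
    (fun=> -oo%E) (fun=> +oo%E) d0; try by [].
  apply: unbounded_cut => out0 in0; rewrite lee_fin.
  have [i UC fU] := min_ext_le0 (h0 UT U0 out0 in0).
  apply: (dT i); apply/tight_setsP; split=> //.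
  have nU : net_out D y U = 0 by rewrite /net_out out0 in0 !big_set0 subrr.
  rewrite sum_excess nU; apply/eqP; rewrite eq_le lerz0 fU andbT.
  by rewrite -nU; apply: yP.
exists (finfun z) => U; rewrite -zd !net_outE.
by apply: eq_bigr => a _; rewrite ffunE.
Qed.

Lemma sum_system_row (G : 'I_2 -> {set V} -> R) :
  (forall i U, U \notin C i -> G i U = 0) ->
  \sum_(r : system_row C) G (val r).1 (val r).2 = \sum_i \sum_U G i U.
Proof.
move=> G0; rewrite pair_big /=.
rewrite -(big_sub [pred r : 'I_2 * {set V} | r.2 \in C r.1]
  (fun r => G r.1 r.2)).
rewrite big_mkcond; apply: eq_bigr => r _ /=.
by case: ifPn => // /G0.
Qed.

Lemma flow_system_tdi :
  totally_dual_integral R (system_lhs D C) (system_rhs C f).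
Proof.
move=> w [y [/solutions_systemE yP ymax']].
have ymax : is_maximizer (flow_polyhedron R D C f) (dotp (int_point R w)) y.
  by split=> // y' /solutions_systemE; apply: ymax'.
have [pi piE] := optimal_potential ymax.
have T12 i : i = ord0 \/ i = ord_max -> tight y i \subset
    tight y ord0 :|: tight y ord_max.
  by case=> ->; [apply: subsetUl|apply: subsetUr].
have [d d0 dT|g1 [g2 [[z1 [t1 [z1P g1E]]] [z2 [t2 [z2P g2E]]] gE]]] :=
  cone_two_families (pi := pi)
    (tight_crossing (i := ord0) yP) (tight_crossing (i := ord_max) yP).
  have [|z zd] := tight_flow (d := d) yP d0.
    by move=> i U /(subsetP (T12 i (ord2_cases i))); apply: dT.
  rewrite -(lerz0 R).
  have -> : (\sum_v pi v * d v)%:~R = dotp (int_point R w) (int_point R z).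
    under eq_bigr => v _ do rewrite -(big_set1 +%R v d) -zd.
    rewrite net_out_dot rmorph_sum; apply: eq_bigr => a _ /=.
    by rewrite !ffunE piE rmorphM.
  apply: optimal_direction ymax _ => i U UT.
  have -> : net_out D (int_point R z) U = (net_out D z U)%:~R.
    by rewrite -net_out_int !net_outE; apply: eq_bigr => a _; rewrite !ffunE.
  by rewrite zd lerz0; apply: dT; apply: subsetP UT; apply/T12/ord2_cases.
pose z (i : 'I_2) U := if i == ord0 then z1 U else z2 U.
have zP i U : 0 <= z i U /\ (z i U != 0 -> U \in tight y i).
  rewrite /z; case: (ord2_cases i) => ->; first exact: z1P.
  exact: z2P.
have z0 i U : U \notin C i -> z i U = 0.
  move=> UC; apply/eqP; apply: contraNT UC => /(zP i U).2.
  by case/tight_setsP.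
pose Z : {ffun system_row C -> int} := [ffun r => z (val r).1 (val r).2].
exists Z; apply: (complementary_slackness (x := y)).
- exact/solutions_systemE.
- split=> [r|a]; first by rewrite !ffunE ler0z; apply: (zP _ _).1.
  under eq_bigr do rewrite !ffunE.
  rewrite (sum_system_row (G := fun i U => (z i U)%:~R *
    ratr ((a \in delta_out D U)%:R - (a \in delta_in D U)%:R))); last first.
    by move=> i U UC; rewrite z0 // mul0r.
  rewrite ffunE piE !gE !g1E !g2E big_ord_recl big_ord1 /= /z /=.
  have rowE (x : {set V} -> int) :
      \sum_U (x U)%:~R *
        ratr ((a \in delta_out D U)%:R - (a \in delta_in D U)%:R)
      = (\sum_U x U * (tail D a \in U)%:R
         - \sum_U x U * (Defs.head D a \in U)%:R)%:~R :> R.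
    rewrite -sumrB rmorph_sum; apply: eq_bigr => U _ /=.
    rewrite rmorphB /= !ratr_nat !inE rmorphB !rmorphM /=.
    by case: (tail D a \in U); case: (Defs.head D a \in U) => /=; ring.
  rewrite !rowE -rmorphD /=; congr (_%:~R); ring.
- move=> r; rewrite !ffunE intr_eq0 => /(zP _ _).2/tight_setsP[_ xf].
  rewrite /system_rhs ratr_int -xf sum_excess net_outE; apply: eq_bigr => a _.
  rewrite /system_lhs rmorphB /= !ratr_nat !inE.
  by case: (tail D a \in _); case: (Defs.head D a \in _);
    rewrite /= ?subrr ?subr0 ?sub0r.
Qed.

End FlowPolyhedron.


Theorem theorem3 (R : realType) (V A : finType) (D : digraph V A)
    (C : 'I_2 -> {set {set V}}) (f : 'I_2 -> {set V} -> int)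
    (hC : forall i : 'I_2, crossing_family (C i))
    (hf : forall i : 'I_2, crossing_submodular (C i) (f i))
    (h0 : forall U : {set V}, U != finset.setT -> U != finset.set0 ->
       delta_out D U = finset.set0 -> delta_in D U = finset.set0 ->
       (min_ext C f U <= 0%:E)%E) :
  (totally_dual_integral R (system_lhs D C) (system_rhs C f) /\
   integral_polyhedron (flow_polyhedron R D C f))
  /\
  (forall l u : A -> \bar int,
     (forall a, l a != +oo%E) -> (forall a, u a != -oo%E) ->
     (forall a, (l a <= u a)%E) ->
     (forall U : {set V}, U != finset.setT -> U != finset.set0 ->
        (min_ext C f U <=
           \sum_(a in delta_out D U) u a - \sum_(a in delta_in D U) l a)%E) ->
     forall F : set {ffun A -> R},
       face (flow_polyhedron R D C f) F -> (exists y, F y) ->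
       exists y : {ffun A -> int},
         F (int_point R y) /\
         (forall a, (l a <= (y a)%:E)%E /\ ((y a)%:E <= u a)%E)).
Proof.
split; last first.
  by move=> l u loo uoo lu cut F; apply: face_integral_point.
split; first exact: flow_system_tdi.
move=> F Fface F0.
have [||||y [Fy _]] := @face_integral_point R V A D C f hC hf
  (fun=> -oo%E) (fun=> +oo%E) F _ _ _ _ Fface F0; try by [].
  by move=> U UT U0; apply: unbounded_cut => out0 in0; apply: h0.
by exists y.
Qed.
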